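(* Let $R=\{(0,0),(0,2),(2,0)\}$. Then $(123,R)\sim_d(132,R)$.
   Context: $S_n$ denotes the set of permutations of $[n]=\{1,\dots,n\}$, written $\pi=\pi_1\cdots\pi_n$. A mesh pattern of length $k$ is a pair $(\tau,R)$ with $\tau\in S_k$ and $R\subseteq\{0,1,\dots,k\}^2$ (the shaded boxes; box $(a,b)$ is the unit square $[a,a+1]\times[b,b+1]$ in the diagram of $\tau$). An occurrence of $(\tau,R)$ in $\pi\in S_n$ is a choice of indices $i_1<\dots<i_k$ such that $\pi_{i_1}\cdots\pi_{i_k}$ is order-isomorphic to $\tau$ and, with $i_0=0$, $i_{k+1}=n+1$, $v_1<\dots<v_k$ the values $\pi_{i_1},\dots,\pi_{i_k}$ sorted increasingly, $v_0=0$, $v_{k+1}=n+1$, for every $(a,b)\in R$ there is no index $m$ with $i_a<m<i_{a+1}$ and $v_b<\pi_m<v_{b+1}$. Mesh patterns $p,q$ are equidistributed, $p\sim_d q$, if for all $n,\ell\ge0$ the number of $\pi\in S_n$ with exactly $\ell$ occurrences of $p$ equals the number with exactly $\ell$ occurrences of $q$. *)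

(* Defs.v *)
From mathcomp Require Import all_boot all_fingroup.
Set Implicit Arguments.
Unset Strict Implicit.
Unset Printing Implicit Defensive.

(* Permutations of [n] are elements of 'S_n, hence act on {0, ..., n-1}: the   *)
(* textbook position i and value pi_i are the successors of the ordinals used  *)
(* here. Shaded boxes keep their textbook coordinates in {0, ..., k}.          *)
Record mesh_pattern (k : nat) := MeshPattern {
  mesh_perm : 'S_k;
  mesh_shading : {set 'I_k.+1 * 'I_k.+1}
}.

Section Occurrences.
Variables (n k : nat).
Implicit Types (p : mesh_pattern k) (pi : 'S_n) (t : k.-tuple 'I_n).

(* i_0 = 0, i_1 < ... < i_k, i_(k+1) = n + 1, numbered from 1.                 *)
Definition pos_bound t (a : nat) : nat :=
  nth n.+1 (0 :: [seq (nat_of_ord i).+1 | i <- t]) a.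

(* v_0 = 0, v_1 < ... < v_k, v_(k+1) = n + 1, numbered from 1.                 *)
Definition val_bound pi t (b : nat) : nat :=
  nth n.+1 (0 :: sort leq [seq (nat_of_ord (pi i)).+1 | i <- t]) b.

Definition in_box pi t (ab : 'I_k.+1 * 'I_k.+1) (m : 'I_n) : bool :=
  (pos_bound t ab.1 < m.+1 < pos_bound t ab.1.+1) &&
  (val_bound pi t ab.2 < (pi m).+1 < val_bound pi t ab.2.+1).

Definition order_isomorphic (tau : 'S_k) pi t : bool :=
  [forall x : 'I_k, forall y : 'I_k,
     (pi (tnth t x) < pi (tnth t y)) == (tau x < tau y)].

Definition occurrence p pi t : bool :=
  [&& sorted ltn [seq nat_of_ord i | i <- t],
      order_isomorphic (mesh_perm p) pi t
    & [forall ab in mesh_shading p, ~~ [exists m : 'I_n, in_box pi t ab m]]].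

Definition num_occurrences p pi : nat :=
  #|[set t : k.-tuple 'I_n | occurrence p pi t]|.

End Occurrences.

Definition equidistributed (k1 k2 : nat)
    (p : mesh_pattern k1) (q : mesh_pattern k2) : Prop :=
  forall n l : nat,
    #|[set pi : 'S_n | num_occurrences p pi == l]| =
    #|[set pi : 'S_n | num_occurrences q pi == l]|.

Notation "p ~d q" := (equidistributed p q) (at level 70, no associativity).

Definition perm123 : 'S_3 := 1%g.
Definition perm132 : 'S_3 := tperm (inord 1) (inord 2).

(* Main.v *)
Require Import Defs.
From mathcomp Require Import all_boot all_fingroup.
From mathcomp Require Import zify.
Set Implicit Arguments.
Unset Strict Implicit.
Unset Printing Implicit Defensive.

(* The left-to-right minima of pi cut the remaining values into maximal         *)
(* intervals; reversing each of these intervals in place is an involution of   *)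
(* 'S_n that keeps the left-to-right minima. In an occurrence, box (0,0) makes *)
(* the first point a left-to-right minimum, and box (0,2) forces the two other *)
(* values into a common interval, since a minimum separating them would lie to *)
(* the left of the first point. The involution thus swaps their order while    *)
(* respecting all the boxes: it carries the occurrences of 123 to those of 132 *)
(* at the same positions.                                                      *)

(** The exchange is exact because a reversed value stays in its gap, so its comparison with every
    left-to-right minimum is unchanged ([gap_rev_cmp]). Hence the minima survive, the map on
    permutations is an involution ([rev_between_minimaK]), and boxes (0,0) and (2,0), which only
    compare values with the minimum [pi i], stay empty. Inside one gap the order is reversed
    ([gap_rev_lt]) and betweenness is kept ([gap_rev_between]): the two upper points are swapped and
    box (0,2) stays empty. [mesh_triple_rev] assembles this, and [num_occurrences_rev] turns it into
    equal counts. *)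

Section GapReversal.

(** * Reflecting the gaps of a set of values *)

Variables (n : nat) (M : {set 'I_n}).
Implicit Types v w x y z : 'I_n.

(** For [v] outside [M], its gap is the half-open interval from [gap_lo v] to [gap_hi v]. Writing
    the upper end, a minimum, as [n] minus a maximum makes the empty case give [n]; for the lower
    end it gives 0. *)
Definition gap_lo v : nat := \max_(w in M | w < v) w.+1.
Definition gap_hi v : nat := n - \max_(w in M | v < w) (n - w).

Lemma gap_lo_le v : gap_lo v <= v.
Proof. by apply/bigmax_leqP => w /andP[]. Qed.

Lemma gap_hi_gt v : v < gap_hi v.
Proof.
have: \max_(w in M | v < w) (n - w) <= n - v.+1.
  by apply/bigmax_leqP => w /andP[_ vw]; lia.
by rewrite /gap_hi; have := ltn_ord v; lia.
Qed.

Lemma gap_hi_le v : gap_hi v <= n.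
Proof. exact: leq_subr. Qed.

Lemma lt_gap_lo v w : w \in M -> w < v -> w < gap_lo v.
Proof.
move=> wM wv.
by apply: (leq_bigmax_cond (F := fun w : 'I_n => w.+1)); rewrite wM.
Qed.

Lemma gap_hi_le_mem v w : w \in M -> v < w -> gap_hi v <= w.
Proof.
move=> wM vw.
have: n - w <= \max_(w in M | v < w) (n - w).
  by apply: (leq_bigmax_cond (F := fun w : 'I_n => n - w)); rewrite wM.
by rewrite /gap_hi; lia.
Qed.

Lemma gap_rev_bound v : gap_lo v + gap_hi v - v.+1 < n.
Proof. by move: (gap_lo_le v) (gap_hi_gt v) (gap_hi_le v); lia. Qed.

(** The reflection of an interval [lo, hi) sends [v] to lo + hi - 1 - v; by [gap_rev_bound] this is
    below [n], so [insubd] never falls back on its default. *)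
Definition gap_rev v : 'I_n :=
  if v \in M then v else insubd v (gap_lo v + gap_hi v - v.+1).

Lemma gap_rev_mem v : v \in M -> gap_rev v = v.
Proof. by rewrite /gap_rev => ->. Qed.

Lemma gap_revE v : v \notin M -> gap_rev v = gap_lo v + gap_hi v - v.+1 :> nat.
Proof. by rewrite /gap_rev => /negbTE ->; rewrite val_insubd gap_rev_bound. Qed.

Lemma gap_rev_cmp v w : w \in M ->
  ((w < gap_rev v) = (w < v)) * ((gap_rev v < w) = (v < w)).
Proof.
move=> wM; case: (boolP (v \in M)) => vM; first by rewrite gap_rev_mem.
have vw : v != w :> nat by apply: contraNneq vM => /val_inj ->.
move: (gap_lo_le v) (gap_hi_gt v); rewrite gap_revE //.
case: (ltngtP v w) vw => // [lt_vw|lt_wv] _.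
  by have := gap_hi_le_mem wM lt_vw; split; lia.
by have := lt_gap_lo wM lt_wv; split; lia.
Qed.

Lemma gap_rev_in v : (gap_rev v \in M) = (v \in M).
Proof.
apply/idP/idP => [rM|vM]; last by rewrite gap_rev_mem.
suff -> : v = gap_rev v by [].
by apply: val_inj => /=; case: (gap_rev_cmp v rM); rewrite !ltnn; lia.
Qed.

(** The ends of a gap depend only on comparisons with [M], so [v] and its image have the same ends,
    and reflecting twice in them is the identity. *)
Lemma gap_revK : involutive gap_rev.
Proof.
move=> v; case: (boolP (v \in M)) => vM; first by rewrite !gap_rev_mem.
apply: val_inj; rewrite /= gap_revE ?gap_rev_in //.
have -> : gap_lo (gap_rev v) = gap_lo v.
  by apply: eq_bigl => w; case: (boolP (w \in M)) => // wM; rewrite gap_rev_cmp.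
have -> : gap_hi (gap_rev v) = gap_hi v.
  congr (n - _); apply: eq_bigl => w.
  by case: (boolP (w \in M)) => // wM; rewrite gap_rev_cmp.
by move: (gap_lo_le v) (gap_hi_gt v); rewrite gap_revE //; lia.
Qed.

(** The interval is closed, so for [x <= y] the endpoints themselves lie outside [M]. *)
Definition same_gap x y := forall w, w \in M -> ~~ (x <= w <= y).

Lemma same_gap_rev x y :
  x <= y -> same_gap x y -> same_gap (gap_rev y) (gap_rev x).
Proof.
move=> xy gxy w wM; move: (gxy w wM).
by case: (gap_rev_cmp x wM) (gap_rev_cmp y wM) => + + []; lia.
Qed.

Lemma gap_rev_lt x y : same_gap x y -> x < y -> gap_rev y < gap_rev x.
Proof.
move=> gxy xy.
have xM : x \notin M by apply/negP => /gxy; rewrite leqnn ltnW.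
have yM : y \notin M by apply/negP => /gxy; rewrite leqnn ltnW.
have lo_eq : gap_lo x = gap_lo y.
  apply: eq_bigl => w; case: (boolP (w \in M)) => //= /gxy; lia.
have hi_eq : gap_hi x = gap_hi y.
  congr (n - _); apply: eq_bigl => w; case: (boolP (w \in M)) => //= /gxy; lia.
move: (gap_lo_le y) (gap_hi_gt y) (gap_lo_le x).
by rewrite !gap_revE // lo_eq hi_eq; lia.
Qed.

(** The reversed values all lie in one gap, so reversing once more flips both inequalities and
    restores [x], [y], [z]. *)
Lemma gap_rev_between x y z : same_gap x y -> x < y ->
  gap_rev y < gap_rev z < gap_rev x -> x < z < y.
Proof.
move=> gxy xy /andP[yz zx].
have gyx := same_gap_rev (ltnW xy) gxy.
have gyz : same_gap (gap_rev y) (gap_rev z) by move=> w /gyx; lia.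
have gzx : same_gap (gap_rev z) (gap_rev x) by move=> w /gyx; lia.
by move: (gap_rev_lt gyz yz) (gap_rev_lt gzx zx); rewrite !gap_revK; lia.
Qed.

End GapReversal.

(** * The involution on permutations and its effect on occurrences *)

Section ReversalBetweenMinima.
Variable n : nat.
Implicit Types (pi : 'S_n) (i j k m u v : 'I_n).

Definition lr_min pi i : bool := [forall m : 'I_n, (m < i) ==> (pi i < pi m)].

Definition lr_min_values pi : {set 'I_n} := pi @: [set i | lr_min pi i].

Lemma mem_lr_min_values pi i : (pi i \in lr_min_values pi) = lr_min pi i.
Proof. by rewrite mem_imset ?inE //; apply: perm_inj. Qed.

Definition rev_between_minima pi : 'S_n :=
  (pi * perm (can_inj (gap_revK (lr_min_values pi))))%g.

Lemma rev_between_minimaE pi i :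
  rev_between_minima pi i = gap_rev (lr_min_values pi) (pi i).
Proof. by rewrite permM permE. Qed.

Lemma not_lr_minP pi i :
  ~~ lr_min pi i -> exists2 m, lr_min pi m & (m < i) && (pi m < pi i).
Proof.
case/forallPn=> m0; rewrite negb_imply -leqNgt => /andP[m0i le_m0i].
(* The witness is the position of the least value among positions up to [i]. *)
have [m mi min_m] := arg_minnP (P := fun m : 'I_n => m <= i)
  (fun m : 'I_n => nat_of_ord (pi m)) (leqnn i).
exists m.
  apply/forallP => m'; apply/implyP => lt_m'm.
  have := min_m m' (leq_trans (ltnW lt_m'm) mi).
  rewrite leq_eqVlt => /orP[/eqP/val_inj/perm_inj mm'|//].
  by rewrite mm' ltnn in lt_m'm.
have lt_m0i : pi m0 < pi i.
  rewrite ltn_neqAle le_m0i andbT; apply: contraTneq m0i => /val_inj/perm_inj ->.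
  by rewrite ltnn.
have lt_mi : pi m < pi i by apply: leq_ltn_trans lt_m0i; apply: min_m; apply: ltnW.
rewrite lt_mi andbT ltn_neqAle mi andbT.
by apply: contraTneq lt_mi => /val_inj ->; rewrite ltnn.
Qed.

(** A minimum keeps its value and its comparisons with all others; a non-minimum has a smaller
    minimum to its left, which still lies below it afterwards. *)
Lemma lr_min_rev pi i : lr_min (rev_between_minima pi) i = lr_min pi i.
Proof.
case: (boolP (lr_min pi i)) => [iM|/not_lr_minP[m mM /andP[mi lt_mi]]].
  apply/forallP => m; apply/implyP => mi; rewrite !rev_between_minimaE.
  have iV : pi i \in lr_min_values pi by rewrite mem_lr_min_values.
  rewrite (gap_rev_mem iV) gap_rev_cmp //.
  by have /forallP/(_ m)/implyP := iM; apply.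
apply/negP => /forallP/(_ m)/implyP/(_ mi); rewrite !rev_between_minimaE.
have mV : pi m \in lr_min_values pi by rewrite mem_lr_min_values.
by rewrite (gap_rev_mem mV) gap_rev_cmp // ltnNge ltnW.
Qed.

Lemma lr_min_values_rev pi :
  lr_min_values (rev_between_minima pi) = lr_min_values pi.
Proof.
rewrite /lr_min_values.
have -> : [set i | lr_min (rev_between_minima pi) i] = [set i | lr_min pi i].
  by apply/setP => i; rewrite !inE lr_min_rev.
apply: eq_in_imset => i; rewrite inE => iM.
by rewrite rev_between_minimaE gap_rev_mem // mem_lr_min_values.
Qed.

Lemma rev_between_minimaK : involutive rev_between_minima.
Proof.
move=> pi; apply/permP => i.
by rewrite !rev_between_minimaE lr_min_values_rev gap_revK.
Qed.

(* [u] and [v] are [j] and [k] in order of increasing value, so that the       *)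
(* patterns 123 and 132 correspond to [(u, v) = (j, k)] and [(k, j)].          *)
Definition mesh_triple pi i j k u v : Prop :=
  [/\ i < j < k, pi i < pi u < pi v, lr_min pi i,
      forall m, m < i -> ~~ (pi u < pi m < pi v)
    & forall m, j < m < k -> pi i <= pi m].

Lemma mesh_triple_rev pi i j k u v : i < u -> i < v ->
  mesh_triple pi i j k u v -> mesh_triple (rev_between_minima pi) i j k v u.
Proof.
move=> iu iv [ijk /andP[lt_iu lt_uv] iM row col].
have iV : pi i \in lr_min_values pi by rewrite mem_lr_min_values.
have Ei : rev_between_minima pi i = pi i by rewrite rev_between_minimaE gap_rev_mem.
(* A minimum with value in this range cannot stand at or after [i], as its value exceeds [pi i].
   Standing before [i], it differs from [u] and [v], hence lies strictly between their values, in
   box (0,2). *)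
have guv : same_gap (lr_min_values pi) (pi u) (pi v).
  move=> w /imsetP[m]; rewrite inE => mM ->{w}; apply/negP => /andP[um mv].
  have mi : m < i.
    rewrite ltnNge; apply/negP; rewrite leq_eqVlt => /orP[/eqP/val_inj E|im].
      by move: um; rewrite -E leqNgt lt_iu.
    by have /forallP/(_ i)/implyP/(_ im) := mM; lia.
  have neq_val (x : 'I_n) : i < x -> pi m != pi x :> nat.
    by move=> ix; apply: contraTneq mi => /val_inj/perm_inj ->; rewrite -leqNgt ltnW.
  by have := row m mi; move: (neq_val u iu) (neq_val v iv); lia.
split=> //.
- rewrite Ei !rev_between_minimaE gap_rev_lt // andbT gap_rev_cmp //.
  exact: ltn_trans lt_uv.
- by rewrite lr_min_rev.
- move=> m mi; apply: contra (row m mi); rewrite !rev_between_minimaE.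
  exact: gap_rev_between.
- move=> m jmk; rewrite Ei rev_between_minimaE leqNgt gap_rev_cmp // -leqNgt.
  exact: col.
Qed.

Lemma order_isomorphic123 pi i j k :
  order_isomorphic perm123 pi [tuple i; j; k] = (pi i < pi j < pi k).
Proof.
apply/forallP/idP => [H|H x].
  have /forallP H0 := H (@Ordinal 3 0 isT); have /forallP H1 := H (@Ordinal 3 1 isT).
  have := H0 (@Ordinal 3 1 isT); have := H1 (@Ordinal 3 2 isT).
  by rewrite !perm1 !(tnth_nth i) /= => /eqP -> /eqP ->.
apply/forallP => y; rewrite !perm1 !(tnth_nth i).
by case: x y => [[|[|[|x]]] ?] [[|[|[|y]]] ?] //=; lia.
Qed.

Lemma perm132E (x : 'I_3) : perm132 x = nth 0 [:: 0; 2; 1] x :> nat.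
Proof.
rewrite /perm132 permE /= -!val_eqE /= !inordK //.
by case: x => [[|[|[|x]]] ?] //=; rewrite inordK.
Qed.

Lemma order_isomorphic132 pi i j k :
  order_isomorphic perm132 pi [tuple i; j; k] = (pi i < pi k < pi j).
Proof.
apply/forallP/idP => [H|H x].
  have /forallP H0 := H (@Ordinal 3 0 isT); have /forallP H2 := H (@Ordinal 3 2 isT).
  have := H0 (@Ordinal 3 2 isT); have := H2 (@Ordinal 3 1 isT).
  by rewrite !perm132E !(tnth_nth i) /= => /eqP -> /eqP ->.
apply/forallP => y; rewrite !perm132E !(tnth_nth i).
by case: x y => [[|[|[|x]]] ?] [[|[|[|y]]] ?] //=; lia.
Qed.

(** Sorting forgets the order of [j] and [k], so one formula serves both patterns. *)
Lemma val_bound_sorted pi i j k u v : perm_eq [:: j; k] [:: u; v] ->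
  pi i < pi u < pi v ->
  val_bound pi [tuple i; j; k] =
    nth n.+1 [:: 0; (pi i).+1; (pi u).+1; (pi v).+1].
Proof.
move=> jkuv lt_iuv; rewrite /val_bound.
suff -> : sort leq [seq (nat_of_ord (pi x)).+1 | x <- [tuple i; j; k]]
          = [:: (pi i).+1; (pi u).+1; (pi v).+1] by [].
rewrite -[RHS](sorted_sort leq_trans); last by rewrite /= !ltnS; lia.
apply/(perm_sortP leq_total leq_trans anti_leq).
by rewrite /= perm_cons; apply: (perm_map (fun x => (nat_of_ord (pi x)).+1)) jkuv.
Qed.

Definition shading : {set 'I_4 * 'I_4} :=
  [set (inord 0, inord 0); (inord 0, inord 2); (inord 2, inord 0)].

Lemma occurrence_mesh_tripleP tau pi i j k u v : perm_eq [:: j; k] [:: u; v] ->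
  order_isomorphic tau pi [tuple i; j; k] = (pi i < pi u < pi v) ->
  reflect (mesh_triple pi i j k u v)
          (occurrence (MeshPattern tau shading) pi [tuple i; j; k]).
Proof.
move=> jkuv Etau; rewrite /occurrence Etau /= andbT.
have boxE (lt_iuv : pi i < pi u < pi v) (a b : nat) m : a < 3 -> b < 3 ->
  in_box pi [tuple i; j; k] (inord a, inord b) m =
  (nth n.+1 [:: 0; i.+1; j.+1; k.+1] a < m.+1 < nth n.+1 [:: i.+1; j.+1; k.+1] a) &&
  (nth n.+1 [:: 0; (pi i).+1; (pi u).+1; (pi v).+1] b < (pi m).+1
     < nth n.+1 [:: (pi i).+1; (pi u).+1; (pi v).+1] b).
  move=> a3 b3; rewrite /in_box (val_bound_sorted jkuv lt_iuv) /pos_bound /=.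
  by rewrite !inordK //; apply: ltn_trans (ltnSn 3).
apply: (iffP and3P) => [[ijk lt_iuv /forallP noBox]|[ijk lt_iuv iM row col]].
  (* Boxes (0,0), (0,2) and (2,0) yield in turn the last three clauses of [mesh_triple]. *)
  have noBoxAt a b m : (inord a, inord b) \in shading ->
      ~~ in_box pi [tuple i; j; k] (inord a, inord b) m.
    by move=> abR; have /implyP/(_ abR)/existsPn := noBox (inord a, inord b); apply.
  split=> //.
  - apply/forallP => m; apply/implyP => mi.
    have := noBoxAt 0 0 m; rewrite !inE eqxx => /(_ isT); rewrite boxE //= !ltnS mi.
    rewrite -leqNgt leq_eqVlt => /orP[/eqP/val_inj/perm_inj E|//].
    by rewrite E ltnn in mi.
  - move=> m mi; have := noBoxAt 0 2 m; rewrite !inE eqxx orbT => /(_ isT).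
    by rewrite boxE //= !ltnS mi.
  - move=> m jmk; have := noBoxAt 2 0 m; rewrite !inE eqxx orbT => /(_ isT).
    by rewrite boxE //= !ltnS; lia.
split=> //; apply/forallP => ab; apply/implyP; rewrite !inE -orbA => /or3P.
case=> /eqP ->; apply/existsPn => m; rewrite boxE //= !ltnS.
- apply/negP => /andP[mi lt_mi]; have /forallP/(_ m)/implyP/(_ mi) := iM; lia.
- by apply/negP => /andP[/row/negP H] /H.
- by apply/negP => /andP[/col]; rewrite leqNgt => /negP.
Qed.

Lemma num_occurrences_rev pi :
  num_occurrences (MeshPattern perm123 shading) pi =
  num_occurrences (MeshPattern perm132 shading) (rev_between_minima pi).
Proof.
apply: eq_card => t; rewrite !inE.
have [i [j [k ->]]] : exists i j k, t = [tuple i; j; k].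
  case: t => [[|i [|j [|k [|? ?]]]] //= t3].
  by exists i, j, k; apply: val_inj.
have P123 := occurrence_mesh_tripleP (perm_refl _) (order_isomorphic123 _ i j k).
have jk : perm_eq [:: j; k] [:: k; j] by rewrite (perm_catC [:: j] [:: k]).
have P132 := occurrence_mesh_tripleP jk
  (order_isomorphic132 _ i j k).
apply/P123/P132 => T; first by apply: (mesh_triple_rev _ _ T); case: T; lia.
(* The converse is the same lemma applied to the image, since the map is an involution. *)
by rewrite -(rev_between_minimaK pi); apply: (mesh_triple_rev _ _ T); case: T; lia.
Qed.

End ReversalBetweenMinima.

Theorem theorem3p5 (R : {set 'I_4 * 'I_4})
    (hR : R = [set (inord 0, inord 0); (inord 0, inord 2); (inord 2, inord 0)]) :
  MeshPattern perm123 R ~d MeshPattern perm132 R.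
Proof.
move=> n l; rewrite hR -/shading.
rewrite -[RHS](on_card_preimset (f := @rev_between_minima n)).
  by apply: eq_card => pi; rewrite !inE num_occurrences_rev.
exact/onW_bij/inv_bij/rev_between_minimaK.
Qed.
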